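(* Let $G=(V,E,d,w)$ be a locally finite weighted graph with weight distribution $w$. For any two distinct vertices $u,v\in V$, $$\kappa(u,v)=\frac{1}{d(u,v)}\sup_B\sum_{x,y\in V}B(x,y)\,d(x,y),$$ where the supremum is taken over all $\ast$-couplings $B$ between $\mu_u$ and $\mu_v$.
   Context: A weighted graph $G=(V,E,d)$ is a connected, locally finite simple graph with a length function $d\colon E\to(0,\infty)$; for arbitrary vertices $x,y$, $d(x,y)$ is the minimum total length of a path joining them, and it is assumed that for every edge this shortest-path distance equals the edge's length. A weight distribution is a function $w\colon E\to(0,\infty)$, $w_{xy}=w_{yx}$; $D_x=\sum_{y\sim x}w_{xy}$. For $\alpha\in[0,1]$, $\mu_x^\alpha(x)=\alpha$, $\mu_x^\alpha(z)=(1-\alpha)\frac{w_{xz}}{D_x}$ if $z\sim x$, $0$ otherwise; $\mu_x:=\mu_x^0$. A coupling between probability measures $\mu_1,\mu_2$ on $V$ is a finitely supported $A\colon V\times V\to[0,1]$ with $\sum_y A(x,y)=\mu_1(x)$, $\sum_x A(x,y)=\mu_2(y)$; $W(\mu_1,\mu_2)=\inf_A\sum_{x,y}A(x,y)d(x,y)$. For $x\neq y$, $\kappa_\alpha(x,y)=1-\frac{W(\mu_x^\alpha,\mu_y^\alpha)}{d(x,y)}$ and $\kappa(x,y)=\lim_{\alpha\to1}\frac{\kappa_\alpha(x,y)}{1-\alpha}$. A $\ast$-coupling between $\mu_u$ and $\mu_v$ is a finitely supported $B\colon V\times V\to\mathbb{R}$ such that: (1) $B(u,v)>0$ and $B(x,y)\le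 0$ for all $(x,y)\neq(u,v)$; (2) $\sum_{x,y\in V}B(x,y)=0$; (3) $\sum_{y\in V}B(x,y)=-\mu_u(x)$ for all $x\neq u$; (4) $\sum_{x\in V}B(x,y)=-\mu_v(y)$ for all $y\neq v$. *)

(* Defs.v *)
From HB Require Import structures.
From mathcomp Require Import all_boot all_order all_algebra.
From mathcomp Require Import all_classical all_reals all_analysis.

Set Implicit Arguments.
Unset Strict Implicit.
Unset Printing Implicit Defensive.

Import Order.TTheory GRing.Theory Num.Theory.
Import numFieldNormedType.Exports.

Local Open Scope classical_set_scope.
Local Open Scope ring_scope.

Section Paths.
Variables (R : realType) (V : choiceType) (e : rel V) (l : V -> V -> R).

(* The path is the sequence x :: p, with pairwise distinct vertices. *)
Definition joins (x y : V) (p : seq V) : bool :=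
  [&& path e x p, uniq (x :: p) & last x p == y].

Fixpoint path_length (x : V) (p : seq V) : R :=
  if p is y :: q then l x y + path_length y q else 0.

(* An infimum: it is the minimum whenever a shortest path exists. *)
Definition path_dist (x y : V) : R :=
  inf [set path_length x p | p in [set p | joins x y p]].

End Paths.

(* Functions on the edge set are encoded as functions of two vertices; their
   values at non-adjacent pairs are unconstrained and never used. *)
Record weighted_graph (R : realType) (V : choiceType) := WeightedGraph {
  adj : rel V;
  edge_length : V -> V -> R;
  adj_sym : symmetric adj;
  adj_irreflexive : irreflexive adj;
  adj_locally_finite : forall x, finite_set [set y | adj x y];
  adj_connected : forall x y, exists p, joins adj x y p;
  edge_length_sym :
    forall x y, adj x y -> edge_length x y = edge_length y x;
  edge_length_gt0 : forall x y, adj x y -> 0 < edge_length x y;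
  edge_length_dist :
    forall x y, adj x y -> path_dist adj edge_length x y = edge_length x y
}.

Section Curvature.
Variables (R : realType) (V : choiceType) (G : weighted_graph R V).

Definition dist (x y : V) : R := path_dist (adj G) (edge_length G) x y.

Definition weight_distribution (w : V -> V -> R) : Prop :=
  forall x y, adj G x y -> 0 < w x y /\ w x y = w y x.

Definition finitely_supported (A : V -> V -> R) : Prop :=
  finite_set [set p : V * V | A p.1 p.2 != 0].

Definition cost (A : V -> V -> R) : R :=
  \sum_(p \in [set: V * V]) A p.1 p.2 * dist p.1 p.2.

Definition coupling (mu1 mu2 : V -> R) (A : V -> V -> R) : Prop :=
  [/\ finitely_supported A,
      (forall x y, 0 <= A x y <= 1),
      (forall x, \sum_(y \in [set: V]) A x y = mu1 x) &
      (forall y, \sum_(x \in [set: V]) A x y = mu2 y)].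

Definition wasserstein (mu1 mu2 : V -> R) : R :=
  inf [set cost A | A in [set A | coupling mu1 mu2 A]].

Definition star_coupling (u v : V) (mu nu : V -> R) (B : V -> V -> R) : Prop :=
  finitely_supported B /\
  [/\ (0 < B u v /\ forall x y, (x, y) <> (u, v) -> B x y <= 0),
      \sum_(p \in [set: V * V]) B p.1 p.2 = 0,
      (forall x, x <> u -> \sum_(y \in [set: V]) B x y = - mu x) &
      (forall y, y <> v -> \sum_(x \in [set: V]) B x y = - nu y)].

Section Weight.
Variable w : V -> V -> R.

Definition weighted_degree (x : V) : R :=
  \sum_(y \in [set y | adj G x y]) w x y.

Definition lazy_measure (alpha : R) (x z : V) : R :=
  if z == x then alpha
  else if adj G x z then (1 - alpha) * (w x z / weighted_degree x)
  else 0.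

Definition kappa_lazy (alpha : R) (x y : V) : R :=
  1 - wasserstein (lazy_measure alpha x) (lazy_measure alpha y) / dist x y.

Definition kappa (x y : V) : R :=
  lim (kappa_lazy alpha x y / (1 - alpha) @[alpha --> 1^'-]).

End Weight.
End Curvature.

(* Main.v *)
(* Write delta for the unit mass at (u, v). For 1/2 <= alpha < 1 the affine map
   B |-> delta - (1 - alpha) B is a bijection from the star couplings of mu_u
   and mu_v onto the couplings of mu_u^alpha and mu_v^alpha: every star coupling
   satisfies B(u, v) <= 2, which keeps the image nonnegative, and conversely
   A(u, v) <= alpha < 1 for a coupling A, which makes B(u, v) positive. It sends
   cost c to d(u, v) - (1 - alpha) c, so W(mu_u^alpha, mu_v^alpha) equals
   d(u, v) - (1 - alpha) sup S, and kappa_alpha(u, v) / (1 - alpha) is constantly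
   sup S / d(u, v) on [1/2, 1). *)
Require Import Defs.
From HB Require Import structures.
From mathcomp Require Import all_boot all_order all_algebra.
From mathcomp Require Import all_classical all_reals all_analysis.
From mathcomp Require Import finmap lra ring.

Set Implicit Arguments.
Unset Strict Implicit.
Unset Printing Implicit Defensive.

Import Order.TTheory GRing.Theory Num.Theory.
Import numFieldNormedType.Exports.

Local Open Scope classical_set_scope.
Local Open Scope ring_scope.

(** * Sums of finitely supported functions *)

Section FiniteSupportSums.
Variable R : realType.

(** A sum over an infinite support is 0 by convention, so linearity and comparison of sums need this
    property. *)
Definition finsupp (T : Type) (f : T -> R) := finite_set [set i | f i != 0].

Lemma finsupp_lin (T : choiceType) (a b : R) (f g : T -> R) :
  finsupp f -> finsupp g -> finsupp (fun i => a * f i + b * g i).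
Proof.
move=> ff fg; apply: (@sub_finite_set _ _
  ([set i | f i != 0] `|` [set i | g i != 0])); last by rewrite finite_setU.
move=> i /= h; have [fi0|] := eqVneq (f i) 0; last by left.
by right; apply: contra_neq h => ->; rewrite fi0 !mulr0 addr0.
Qed.

Lemma fsum_lin (T : choiceType) (a b : R) (f g : T -> R) :
  finsupp f -> finsupp g ->
  \sum_(i \in [set: T]) (a * f i + b * g i) =
  a * (\sum_(i \in [set: T]) f i) + b * (\sum_(i \in [set: T]) g i).
Proof.
move=> ff fg.
(* One finite set [X] containing both supports lets all three sums range over the same indices. *)
have : finite_set ([set i | f i != 0] `|` [set i | g i != 0]).
  by rewrite finite_setU.
move=> /finite_fsetP[X XE].
have f0 i : i \notin X -> f i = 0.
  by apply: contraNeq => fi; have : [set` X] i by rewrite -XE; left.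
have g0 i : i \notin X -> g i = 0.
  by apply: contraNeq => gi; have : [set` X] i by rewrite -XE; right.
rewrite !(@fsbigTE _ _ _ _ X) //; last first.
  by move=> i iX; rewrite f0// g0// !mulr0 addr0.
by rewrite big_split /= !mulr_sumr.
Qed.

Lemma finsupp_delta (T : choiceType) (j : T) :
  finsupp (fun i : T => (i == j)%:R : R).
Proof.
apply: (sub_finite_set _ (finite_set1 j)) => i /=.
by have [//|] := eqVneq i j; rewrite eqxx.
Qed.

Lemma fsum_delta (T : choiceType) (j : T) (f : T -> R) :
  \sum_(i \in [set: T]) (i == j)%:R * f i = f j.
Proof.
rewrite -[RHS](@fsbig_set1 _ 0 +%R _ j f) [RHS]fsbig_mkcond.
apply: eq_fsbigr => i _; rewrite /patch.
have [->|/eqP ij] := eqVneq i j; first by rewrite mem_set// mul1r.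
by rewrite memNset// mul0r.
Qed.

Lemma fsum_delta1 (T : choiceType) (j : T) :
  \sum_(i \in [set: T]) ((i == j)%:R : R) = 1.
Proof.
rewrite -[RHS](fsum_delta j (fun=> 1)).
by apply: eq_fsbigr => i _; rewrite mulr1.
Qed.

Lemma le_fsum (T : choiceType) (f g : T -> R) :
  finsupp f -> finsupp g -> (forall i, f i <= g i) ->
  \sum_(i \in [set: T]) f i <= \sum_(i \in [set: T]) g i.
Proof.
move=> ff fg le_fg; rewrite -subr_ge0.
have -> : \sum_(i \in [set: T]) g i - \sum_(i \in [set: T]) f i =
          \sum_(i \in [set: T]) (1 * g i + -1 * f i).
  by rewrite fsum_lin// mul1r mulN1r.
by apply: fsumr_ge0 => i _; rewrite mul1r mulN1r subr_ge0.
Qed.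

(** Compare [f] with its restriction to the point [j], whose sum is [f j]. *)
Lemma le_term_fsum (T : choiceType) (f : T -> R) (j : T) :
  finsupp f -> (forall i, 0 <= f i) -> f j <= \sum_(i \in [set: T]) f i.
Proof.
move=> ff f0; rewrite -[leLHS](fsum_delta j f); apply: le_fsum => // [|i].
  apply: (sub_finite_set _ ff) => i /=.
  by apply: contra_neq => ->; rewrite mulr0.
by have [_|_] := eqVneq i j; rewrite ?mul1r ?mul0r.
Qed.

Variable V : choiceType.
Implicit Type A : V -> V -> R.

Lemma finsupp_row A x : finitely_supported A -> finsupp (A x).
Proof.
move=> /(finite_image snd); apply: sub_finite_set => y /= Axy.
by exists (x, y).
Qed.

Lemma finsupp_col A y : finitely_supported A -> finsupp (A ^~ y).
Proof.
move=> /(finite_image fst); apply: sub_finite_set => x /= Axy.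
by exists (x, y).
Qed.

(** Both sides reduce to the finite rectangle spanned by the two projections of the support, where
    the sum over pairs can be iterated. *)
Lemma fsum_pair A : finitely_supported A ->
  \sum_(p \in [set: V * V]) A p.1 p.2 =
  \sum_(x \in [set: V]) \sum_(y \in [set: V]) A x y.
Proof.
move=> fA; set D := [set p | A p.1 p.2 != 0] in fA.
have fX := finite_image fst fA; have fY := finite_image snd fA.
have A0 x y : ~ ((fst @` D) x /\ (snd @` D) y) -> A x y = 0.
  by apply: contra_notP => /eqP Axy; split; exists (x, y).
rewrite -(@fsbig_widen _ _ _ _ ((fst @` D) `*` (snd @` D))) //; last first.
  by move=> [x y] [_ /A0].
rewrite -pair_fsbig //.
rewrite -[RHS](@fsbig_widen _ _ _ _ (fst @` D)) //; last first.
  move=> x [_ Dx] /=; apply: fsbig1 => y _; apply: A0.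
  by case=> /Dx.
apply: eq_fsbigr => x _; apply: fsbig_widen => // y [_ Dy] /=; apply: A0.
by case=> _ /Dy.
Qed.

Lemma fsum_pairC A : finitely_supported A ->
  \sum_(p \in [set: V * V]) A p.1 p.2 =
  \sum_(y \in [set: V]) \sum_(x \in [set: V]) A x y.
Proof.
move=> fA; rewrite -(@fsum_pair (fun y x => A x y)).
  pose swap (p : V * V) := (p.2, p.1).
  have swapK : involutive swap by case.
  by rewrite (@reindex_fsbigT _ _ _ _ _ swap) //; exists swap.
have := finite_image (fun p : V * V => (p.2, p.1)) fA.
apply: sub_finite_set => -[y x] /= Axy; by exists (x, y).
Qed.

End FiniteSupportSums.

(** * Positivity of the graph distance *)

Section Distance.
Variables (R : realType) (V : choiceType) (G : weighted_graph R V).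

Lemma path_length_ge0 x p : path (adj G) x p ->
  0 <= path_length (edge_length G) x p.
Proof.
elim: p x => //= y p IHp x /andP[/(@edge_length_gt0 _ _ G)/ltW ? /IHp ?].
exact: addr_ge0.
Qed.

Lemma dist_ge0 x y : 0 <= dist G x y.
Proof.
apply: lb_le_inf => [|_ [p /and3P[? _ _] <-]]; last exact: path_length_ge0.
have [p xpy] := adj_connected G x y.
by exists (path_length (edge_length G) x p), p.
Qed.

Lemma edge_length_lbound x :
  exists2 m : R, 0 < m & forall y, adj G x y -> m <= edge_length G x y.
Proof.
have /finite_seqP[s sE] := adj_locally_finite G x.
(* Starting the minimum at 1 keeps it positive even when there are no neighbours. *)
exists (\big[Order.min/1]_(y <- s) edge_length G x y).
  rewrite big_seq; apply: (big_ind (fun t => 0 < t)) => //.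
    by move=> a b a0 b0; rewrite lt_min a0.
  move=> y ys; apply: edge_length_gt0.
  by have : [set` s] y by []; rewrite -sE.
move=> y xy; apply: ge_bigmin_seq => //.
by have : [set y | adj G x y] y by []; rewrite sE.
Qed.

(** Positive path lengths could still have infimum 0. But every path from [x] to another vertex
    starts with an edge at [x], and local finiteness bounds these edges below by one positive
    constant. *)
Lemma dist_gt0 x y : x <> y -> 0 < dist G x y.
Proof.
move=> xy; have [m m0 le_m] := edge_length_lbound x.
apply: lt_le_trans m0 _; apply: lb_le_inf => [|_ [p /= + <-]].
  have [p xpy] := adj_connected G x y.
  by exists (path_length (edge_length G) x p), p.
case: p => [|z p] /and3P[/= + _]; first by move=> _ /eqP.
move=> /andP[xz zp] _; rewrite (le_trans (le_m _ xz))// lerDl.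
exact: path_length_ge0.
Qed.

End Distance.

(** * Lazy measures as probability measures *)

Section LazyMeasure.
Variables (R : realType) (V : choiceType) (G : weighted_graph R V).
Variables (w : V -> V -> R) (hw : weight_distribution G w).
Variables (u v : V) (huv : u <> v).

(** Connectedness and the second vertex [v] give [u] a neighbour, so the degree is not an empty
    sum. *)
Lemma weighted_degree_gt0 : 0 < weighted_degree G w u.
Proof.
have w_ge0 y : [set y | adj G u y] y -> 0 <= w u y by move=> /hw[/ltW].
rewrite lt0r fsumr_ge0// andbT; apply/eqP.
move=> /(pfsumr_eq0 (adj_locally_finite G u) w_ge0) w0.
have [[|y p] /and3P[/= + _]] := adj_connected G u v; first by move=> _ /eqP.
by move=> /andP[uy _] _; have [+ _] := hw uy; rewrite w0 ?ltxx.
Qed.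

(** This is the marginal counterpart of delta - (1 - alpha) B, since the rows of a star coupling sum
    to the indicator of [u] minus [mu 0 u]. *)
Lemma lazy_measureE (alpha : R) z : lazy_measure G w alpha u z =
  (z == u)%:R - (1 - alpha) * ((z == u)%:R - lazy_measure G w 0 u z).
Proof.
rewrite /lazy_measure; have [_|_] := eqVneq z u => /=; first by ring.
by case: ifP => _; ring.
Qed.

Lemma lazy_measure_ge0 (alpha : R) z : 0 <= alpha <= 1 ->
  0 <= lazy_measure G w alpha u z.
Proof.
move=> /andP[a0 a1]; rewrite /lazy_measure; case: eqP => // _.
case: ifP => // /hw[wuz _].
by rewrite mulr_ge0 ?subr_ge0// divr_ge0 ?ltW// weighted_degree_gt0.
Qed.

Lemma finsupp_lazy_measure (alpha : R) : finsupp (lazy_measure G w alpha u).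
Proof.
apply: (@sub_finite_set _ _ ([set u] `|` [set y | adj G u y])).
  move=> z /=; rewrite /lazy_measure; have [->|_] := eqVneq z u; first by left.
  by case: ifP => [uz|]; [right|rewrite eqxx].
by rewrite finite_setU; split; [exact: finite_set1|exact: adj_locally_finite].
Qed.

(** For [alpha = 0] the weights are normalised by the degree; the general measure is a combination,
    with coefficients [alpha] and [1 - alpha], of the unit mass at [u] and that case. *)
Lemma fsum_lazy_measure (alpha : R) :
  \sum_(z \in [set: V]) lazy_measure G w alpha u z = 1.
Proof.
have sum0 : \sum_(z \in [set: V]) lazy_measure G w 0 u z = 1.
  have D0 := weighted_degree_gt0.
  rewrite -(mulVf (lt0r_neq0 D0)) mulr_fsumr [RHS]fsbig_mkcond.
  apply: eq_fsbigr => z _; rewrite /patch /lazy_measure.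
  have [uz|/negP uz] := boolP (adj G u z).
    rewrite mem_set//; have [zu|_] := eqVneq z u.
      by rewrite zu adj_irreflexive in uz.
    by rewrite subr0 mul1r mulrC.
  by rewrite memNset// if_same.
have fsl := finsupp_lazy_measure 0; have fsd := @finsupp_delta R _ u.
transitivity (\sum_(z \in [set: V])
    (alpha * (z == u)%:R + (1 - alpha) * lazy_measure G w 0 u z)).
  by apply: eq_fsbigr => z _; rewrite lazy_measureE; ring.
by rewrite fsum_lin// fsum_delta1 sum0; ring.
Qed.

Lemma lazy_measure_le1 (alpha : R) z : 0 <= alpha <= 1 ->
  lazy_measure G w alpha u z <= 1.
Proof.
move=> a01; rewrite -(fsum_lazy_measure alpha).
by apply: le_term_fsum => [|i]; [exact: finsupp_lazy_measure
  |exact: lazy_measure_ge0].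
Qed.

End LazyMeasure.

(** * The correspondence between couplings and star couplings *)

Section StarCouplings.
Variables (R : realType) (V : choiceType) (G : weighted_graph R V).
Variables (w : V -> V -> R) (hw : weight_distribution G w).
Variables (u v : V) (huv : u <> v).

Let hvu : v <> u. Proof. exact: nesym. Qed.
Local Notation mu := (lazy_measure G w).
Implicit Types (A B : V -> V -> R) (a b alpha : R).

(** The product form lets row and column sums factor; [pair_deltaE] recovers the indicator of (u,
    v). *)
Definition pair_delta (x y : V) : R := (x == u)%:R * (y == v)%:R.

(* Both [A = delta - (1 - alpha) B] and its inverse
   [B = (delta - A) / (1 - alpha)] have this form. *)
Definition delta_comb a b B x y := a * pair_delta x y + b * B x y.

Lemma pair_deltaE x y : pair_delta x y = ((x, y) == (u, v))%:R.
Proof. by rewrite /pair_delta xpair_eqE -natrM mulnb. Qed.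

Lemma finitely_supported_pair_delta : finitely_supported pair_delta.
Proof.
apply: (sub_finite_set _ (finite_set1 (u, v))) => -[x y] /=.
by rewrite pair_deltaE; have [//|] := eqVneq (x, y) (u, v); rewrite eqxx.
Qed.

Lemma finitely_supported_delta_comb a b B :
  finitely_supported B -> finitely_supported (delta_comb a b B).
Proof.
move=> fB; exact: (@finsupp_lin R _ a b (fun p => pair_delta p.1 p.2)
  (fun p => B p.1 p.2) finitely_supported_pair_delta fB).
Qed.

Lemma fsum_delta_comb a b B : finitely_supported B ->
  \sum_(p \in [set: V * V]) delta_comb a b B p.1 p.2 =
  a + b * \sum_(p \in [set: V * V]) B p.1 p.2.
Proof.
move=> fB.
rewrite (fsum_lin (f := fun p : V * V => pair_delta p.1 p.2)
  (g := fun p => B p.1 p.2) _ _ finitely_supported_pair_delta fB).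
congr (_ + _); rewrite -[RHS]mulr1 -(@fsum_delta1 R _ (u, v)); congr (_ * _).
by apply: eq_fsbigr => -[x y] _; rewrite pair_deltaE.
Qed.

Lemma fsum_delta_comb_row a b B x : finitely_supported B ->
  \sum_(y \in [set: V]) delta_comb a b B x y =
  a * (x == u)%:R + b * \sum_(y \in [set: V]) B x y.
Proof.
move=> fB; rewrite fsum_lin; last 2 first.
- exact: (finsupp_row x finitely_supported_pair_delta).
- exact: finsupp_row.
by rewrite -mulr_fsumr fsum_delta1 mulr1.
Qed.

Lemma fsum_delta_comb_col a b B y : finitely_supported B ->
  \sum_(x \in [set: V]) delta_comb a b B x y =
  a * (y == v)%:R + b * \sum_(x \in [set: V]) B x y.
Proof.
move=> fB; rewrite (fsum_lin (f := pair_delta ^~ y) (g := B ^~ y) a b); last 2 first.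
- exact: (finsupp_col y finitely_supported_pair_delta).
- exact: finsupp_col.
by rewrite -mulr_fsuml fsum_delta1 mul1r.
Qed.

Lemma cost_delta_comb a b B : finitely_supported B ->
  cost G (delta_comb a b B) = a * dist G u v + b * cost G B.
Proof.
move=> fB.
have fd C : finitely_supported C ->
    finsupp (fun p : V * V => C p.1 p.2 * dist G p.1 p.2).
  apply: sub_finite_set => p /=.
  by apply: contra_neq => ->; rewrite mul0r.
transitivity (\sum_(p \in [set: V * V]) (a * (pair_delta p.1 p.2 * dist G p.1 p.2)
    + b * (B p.1 p.2 * dist G p.1 p.2))).
  by apply: eq_fsbigr => p _; rewrite mulrDl -!mulrA.
rewrite (fsum_lin (f := fun p : V * V => pair_delta p.1 p.2 * dist G p.1 p.2)
  (g := fun p => B p.1 p.2 * dist G p.1 p.2) a b); last 2 first.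
- exact: (fd _ finitely_supported_pair_delta).
- exact: (fd _ fB).
congr (a * _ + _).
rewrite -(fsum_delta (u, v) (fun p => dist G p.1 p.2)).
by apply: eq_fsbigr => -[x y] _; rewrite pair_deltaE.
Qed.

Lemma star_of_coupling alpha A : 0 <= alpha < 1 ->
  coupling (mu alpha u) (mu alpha v) A ->
  star_coupling u v (mu 0 u) (mu 0 v)
    (delta_comb (1 - alpha)^-1 (- (1 - alpha)^-1) A).
Proof.
move=> /andP[a0 a1] [fA A01 rowA colA].
have b0 : 0 < 1 - alpha by rewrite subr_gt0.
have a01 : 0 <= alpha <= 1 by rewrite a0 ltW.
have bn0 := lt0r_neq0 b0.
split; first exact: finitely_supported_delta_comb.
split.
- split=> [|x y xy].
  + rewrite /delta_comb pair_deltaE eqxx mulr1 mulNr -[X in X - _]mulr1 -mulrBr.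
    rewrite mulr_gt0 ?invr_gt0// subr_gt0 (le_lt_trans _ a1)//.
    (* The entry [A u v] is at most the sum of row [u], which is [alpha]. *)
    have -> : alpha = \sum_(y \in [set: V]) A u y.
      by rewrite rowA /lazy_measure eqxx.
    apply: le_term_fsum => [|y]; first exact: finsupp_row.
    by case/andP: (A01 u y).
  + rewrite /delta_comb pair_deltaE (introF eqP xy) mulr0 add0r mulNr oppr_le0.
    by have /andP[? _] := A01 x y; rewrite mulr_ge0// invr_ge0 ltW.
- rewrite fsum_delta_comb// fsum_pair//; under eq_fsbigr do rewrite rowA.
  by rewrite (fsum_lazy_measure hw huv) mulr1 subrr.
- move=> x /eqP xu; rewrite fsum_delta_comb_row// rowA lazy_measureE (negbTE xu) /=.
  by field.
- move=> y /eqP yv; rewrite fsum_delta_comb_col// colA lazy_measureE (negbTE yv) /=.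
  by field.
Qed.

(** The definition fixes every row sum except that of row [u]. The zero total and the unit mass of
    [mu 0 u] force the remaining one to be 1. *)
Lemma star_coupling_row B x : star_coupling u v (mu 0 u) (mu 0 v) B ->
  \sum_(y \in [set: V]) B x y = (x == u)%:R - mu 0 u x.
Proof.
move=> [fB [_ sumB rowB _]].
(* The unknown sum of row [u] becomes a coefficient; the formula also holds at [u] because
   [mu 0 u u = 0]. *)
have rowE z : \sum_(y \in [set: V]) B z y =
    (\sum_(y \in [set: V]) B u y) * (z == u)%:R + -1 * mu 0 u z.
  have [->|/eqP/rowB ->] := eqVneq z u; last by rewrite /=; ring.
  by rewrite /lazy_measure eqxx /=; ring.
suff rowu : \sum_(y \in [set: V]) B u y = 1 by rewrite rowE rowu; ring.
move: sumB; rewrite fsum_pair//; under eq_fsbigr do rewrite rowE.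
rewrite fsum_lin; [|exact: finsupp_delta|exact: finsupp_lazy_measure].
rewrite fsum_delta1 (fsum_lazy_measure hw huv); lra.
Qed.

Lemma star_coupling_col B y : star_coupling u v (mu 0 u) (mu 0 v) B ->
  \sum_(x \in [set: V]) B x y = (y == v)%:R - mu 0 v y.
Proof.
move=> [fB [_ sumB _ colB]].
have colE z : \sum_(x \in [set: V]) B x z =
    (\sum_(x \in [set: V]) B x v) * (z == v)%:R + -1 * mu 0 v z.
  have [->|/eqP/colB ->] := eqVneq z v; last by rewrite /=; ring.
  by rewrite /lazy_measure eqxx /=; ring.
suff colv : \sum_(x \in [set: V]) B x v = 1 by rewrite colE colv; ring.
move: sumB; rewrite fsum_pairC//; under eq_fsbigr do rewrite colE.
rewrite fsum_lin; [|exact: finsupp_delta|exact: finsupp_lazy_measure].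
rewrite fsum_delta1 (fsum_lazy_measure hw hvu); lra.
Qed.

(* Column [y <> v] has sum [- mu 0 v y] and nonpositive entries, so
   [B u y >= - mu 0 v y]; summing over row [u], whose total is 1, gives
   [1 >= B u v - 1]. *)
Lemma star_coupling_le2 B : star_coupling u v (mu 0 u) (mu 0 v) B ->
  B u v <= 2.
Proof.
move=> sB; have [fB [[_ B_le0] _ _ colB]] := sB.
have B_ge y : B u v * (y == v)%:R + -1 * mu 0 v y <= B u y.
  have [->|/eqP yv] := eqVneq y v; first by rewrite /lazy_measure eqxx /=; lra.
  rewrite mulr0 add0r mulN1r -(colB _ yv) -lerN2.
  have -> : - \sum_(x \in [set: V]) B x y = \sum_(x \in [set: V]) - B x y.
    by rewrite -mulN1r mulr_fsumr; apply: eq_fsbigr => x _; rewrite mulN1r.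
  apply: (@le_term_fsum _ _ (fun x => - B x y)) => [|x].
    apply: sub_finite_set (finsupp_col y fB) => x /=.
    by rewrite oppr_eq0.
  by rewrite oppr_ge0; apply: B_le0 => -[_].
have fd := @finsupp_delta R _ v; have fl := finsupp_lazy_measure G w v 0.
have := le_fsum (finsupp_lin (B u v) (-1) fd fl) (finsupp_row u fB) B_ge.
rewrite fsum_lin// fsum_delta1 (fsum_lazy_measure hw hvu).
by rewrite (star_coupling_row u sB) eqxx /lazy_measure eqxx /=; lra.
Qed.

Lemma coupling_of_star alpha B : 2^-1 <= alpha < 1 ->
  star_coupling u v (mu 0 u) (mu 0 v) B ->
  coupling (mu alpha u) (mu alpha v) (delta_comb 1 (- (1 - alpha)) B).
Proof.
move=> /andP[a2 a1] sB; have [fB [[_ B_le0] _ _ _]] := sB.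
have b0 : 0 < 1 - alpha by rewrite subr_gt0.
have fA := finitely_supported_delta_comb 1 (- (1 - alpha)) fB.
have rowA x : \sum_(y \in [set: V]) delta_comb 1 (- (1 - alpha)) B x y = mu alpha u x.
  by rewrite fsum_delta_comb_row// star_coupling_row// [RHS]lazy_measureE; ring.
have A_ge0 x y : 0 <= delta_comb 1 (- (1 - alpha)) B x y.
  rewrite /delta_comb pair_deltaE mul1r.
  have [[-> ->]|/eqP xy] := eqVneq (x, y) (u, v).
    (* Here 1 - alpha <= 1/2 and [B u v <= 2], so 1 - (1 - alpha) B(u, v) >= 0. *)
    by have := star_coupling_le2 sB; rewrite /=; nra.
  by rewrite add0r mulNr oppr_ge0 pmulr_rle0//; exact: B_le0.
split=> // [x y|y].
  (* A nonnegative entry is at most its row sum, a value of a probability measure. *)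
  rewrite A_ge0/= (le_trans (le_term_fsum y (finsupp_row x fA) (A_ge0 x)))//.
  rewrite rowA (lazy_measure_le1 hw huv)//; lra.
by rewrite fsum_delta_comb_col// star_coupling_col// [RHS]lazy_measureE; ring.
Qed.

(** The independent coupling shows that the infimum, and through [star_of_coupling] the supremum,
    ranges over a nonempty set. *)
Lemma coupling_product alpha : 0 <= alpha <= 1 ->
  coupling (mu alpha u) (mu alpha v) (fun x y => mu alpha u x * mu alpha v y).
Proof.
move=> a01.
have mu_ge0 x := lazy_measure_ge0 hw huv x a01.
have mv_ge0 x := lazy_measure_ge0 hw hvu x a01.
have mu_le1 x := lazy_measure_le1 hw huv x a01.
have mv_le1 x := lazy_measure_le1 hw hvu x a01.
split.
- apply: sub_finite_set (finite_setX (finsupp_lazy_measure G w u alpha)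
    (finsupp_lazy_measure G w v alpha)) => -[x y] /=.
  by rewrite mulf_eq0 negb_or => /andP[].
- by move=> x y; rewrite mulr_ge0//= mulr_ile1.
- by move=> x; rewrite -mulr_fsumr (fsum_lazy_measure hw hvu) mulr1.
- by move=> y; rewrite -mulr_fsuml (fsum_lazy_measure hw huv) mul1r.
Qed.

(** * Optimal costs and the curvature limit *)

Lemma cost_ge0 A : (forall x y, 0 <= A x y) -> 0 <= cost G A.
Proof. by move=> A0; apply: fsumr_ge0 => p _; rewrite mulr_ge0// dist_ge0. Qed.

Local Notation S :=
  ([set cost G B | B in [set B | star_coupling u v (mu 0 u) (mu 0 v) B]]).

Lemma has_sup_star_cost : has_sup S.
Proof.
have h1 : 0 <= (2^-1 : R) < 1 by lra.
have h2 : 2^-1 <= (2^-1 : R) < 1 by lra.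
have h3 : 0 <= (2^-1 : R) <= 1 by lra.
split.
  eexists; exists (delta_comb (1 - 2^-1)^-1 (- (1 - 2^-1)^-1)
    (fun x y => mu 2^-1 u x * mu 2^-1 v y)); last by [].
  by apply: star_of_coupling => //; exact: coupling_product.
(* At [alpha = 2^-1] the coupling built from [B] has cost d(u, v) - c/2 >= 0, where c is the cost of
   [B]; hence the factor 2. *)
exists (2 * dist G u v) => _ [B sB <-].
have [fA A01 _ _] := coupling_of_star h2 sB.
have : 0 <= cost G (delta_comb 1 (- (1 - 2^-1)) B).
  by apply: cost_ge0 => x y; case/andP: (A01 x y).
by rewrite cost_delta_comb; [lra|case: sB].
Qed.

Lemma wasserstein_lazy alpha : 2^-1 <= alpha < 1 ->
  wasserstein G (mu alpha u) (mu alpha v) = dist G u v - (1 - alpha) * sup S.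
Proof.
move=> ha; have /andP[a2 a1] := ha.
have a01 : 0 <= alpha < 1 by lra.
have a01' : 0 <= alpha <= 1 by lra.
have b0 : 0 < 1 - alpha by lra.
have [S0 Sub] := has_sup_star_cost.
apply/eqP; rewrite eq_le; apply/andP; split.
  (* Solved for [sup S], this inequality can be checked on each star coupling [B], whose image is a
     competitor for the infimum. *)
  rewrite lerBrDl -lerBrDr -ler_pdivlMl//; apply: ge_sup => // _ [B sB <-].
  rewrite ler_pdivlMl// lerBrDr -lerBrDl.
  apply: ge_inf.
    exists 0 => _ [A [_ A01 _ _] <-].
    by apply: cost_ge0 => x y; case/andP: (A01 x y).
  exists (delta_comb 1 (- (1 - alpha)) B); first exact: coupling_of_star.
  by rewrite cost_delta_comb; [ring|case: sB].
(* Conversely, each coupling yields a star coupling, whose cost is at most [sup S]. *)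
apply: lb_le_inf.
  by eexists; eexists; [exact: coupling_product|by []].
move=> _ [A cA <-].
have [fA _ _ _] := cA.
have : S (cost G (delta_comb (1 - alpha)^-1 (- (1 - alpha)^-1) A)).
  by eexists; [exact: star_of_coupling cA|].
move=> /(ub_le_sup Sub); rewrite cost_delta_comb// mulNr -mulrBr.
by rewrite ler_pdivrMl//; lra.
Qed.

(** Dividing the formula for W by d(u, v) leaves (1 - alpha) sup S / d(u, v), and the factor 1 -
    alpha cancels. *)
Lemma kappa_lazy_star alpha : 2^-1 <= alpha < 1 ->
  kappa_lazy G w alpha u v / (1 - alpha) = (dist G u v)^-1 * sup S.
Proof.
move=> ha; rewrite /kappa_lazy wasserstein_lazy//.
have d0 := lt0r_neq0 (dist_gt0 G huv).
have a0 : 1 - alpha != 0 by case/andP: ha => _ ?; rewrite subr_eq0 gt_eqF.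
by field; rewrite d0.
Qed.

End StarCouplings.

Theorem theorem2p14 (R : realType) (V : choiceType) (G : weighted_graph R V)
    (w : V -> V -> R) (hw : weight_distribution G w) (u v : V) (huv : u <> v) :
  let S := [set cost G B | B in
    [set B | star_coupling u v (lazy_measure G w 0 u) (lazy_measure G w 0 v) B]] in
  [/\ cvg (kappa_lazy G w alpha u v / (1 - alpha) @[alpha --> 1^'-]),
      has_sup S &
      kappa G w u v = (dist G u v)^-1 * sup S].
Proof.
(* [lim] and [sup] have default values when the limit or supremum does not exist, so existence of
   both is proved along with the equation. *)
move=> S; set L := (dist G u v)^-1 * sup S.
have cvgL : kappa_lazy G w alpha u v / (1 - alpha) @[alpha --> 1^'-] --> L.
  apply: cvg_near_cst; near=> alpha; apply: (kappa_lazy_star hw huv).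
  apply/andP; split; near: alpha.
    by apply: nbhs_left_ge; lra.
  exact: nbhs_left_lt.
split; [by apply/cvg_ex; exists L|exact: has_sup_star_cost|].
exact: cvg_lim cvgL.
Unshelve. all: by end_near.
Qed.
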